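(* Let $k$ be an algebraically closed field and $A$ a finite-dimensional unital associative $k$-algebra. The poset $\mathcal{L}_t(A)$ of pretorsion classes of $\mathrm{mod}\,A$, ordered by inclusion, is a complete lattice, with meet and join given, for every $\mathcal{T}_1,\mathcal{T}_2\in\mathcal{L}_t(A)$, by $$\mathcal{T}_1\wedge\mathcal{T}_2=\mathcal{T}_1\cap\mathcal{T}_2\qquad\text{and}\qquad \mathcal{T}_1\vee\mathcal{T}_2=\mathrm{Gen}(\mathcal{T}_1\cup\mathcal{T}_2).$$
   Context: $\mathrm{mod}\,A$ is the category of finitely generated right $A$-modules. All subcategories are full and closed under isomorphisms. A pretorsion class of $\mathrm{mod}\,A$ is a subcategory containing $0$ and closed under quotients and finite direct sums. For a class $\mathcal{S}$ of modules in $\mathrm{mod}\,A$, $\mathrm{Gen}(\mathcal{S})$ is the smallest pretorsion class containing $\mathcal{S}$, i.e. the subcategory of all quotients of finite direct sums of modules in $\mathcal{S}$. *)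

(* Defs.v *)
From HB Require Import structures.
From mathcomp Require Import all_boot all_order all_algebra.
From mathcomp Require Import falgebra boolp.

Set Implicit Arguments.
Unset Strict Implicit.
Unset Printing Implicit Defensive.

Import GRing.Theory.
Local Open Scope ring_scope.

(* The algebra structure is a central ring morphism from the field.  The
   library's falgType is not used because it excludes the zero algebra. *)
Definition fin_dim_algebra (k : fieldType) (A : pzRingType)
    (iota : {rmorphism k -> A}) : Prop :=
  (forall (c : k) (a : A), iota c * a = a * iota c) /\
  (exists (n : nat) (b : 'I_n -> A), forall a : A,
     exists c : 'I_n -> k, a = \sum_(i < n) iota (c i) * b i).

Lemma falgType_fin_dim_algebra (k : fieldType) (A : falgType k) :
  fin_dim_algebra (in_alg A : {rmorphism k -> A}).
Proof.
split=> [c a|]; first by rewrite /= mulr_algl mulr_algr.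
exists (\dim {:A}), (fun i => (vbasis {:A})`_i) => a.
exists (fun i => coord (vbasis {:A}) i a).
rewrite {1}(coord_vbasis (memvf a)).
by apply: eq_bigr => i _; rewrite /= mulr_algl.
Qed.

(* A left module over the converse ring is a right A-module:
   a *: (b *: m) = (b * a) *: m, the product b * a being taken in A. *)
Notation rmodType A := (lmodType A^c).

Definition surjective (U V : Type) (f : U -> V) : Prop :=
  forall v, exists u, f u = v.

Section FiniteDirectSum.
Variables (R : pzRingType) (I : finType) (M : I -> lmodType R).

(* I is finite, so the direct sum is the full product. *)
Definition dirsum : Type := forall i : I, M i.

HB.instance Definition _ := Choice.on dirsum.

Implicit Types (x y z : dirsum) (a b : R).

Let zero : dirsum := fun=> 0.
Let opp x : dirsum := fun i => - x i.
Let add x y : dirsum := fun i => x i + y i.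
Let scale a x : dirsum := fun i => a *: x i.

Let addA : associative add.
Proof. by move=> x y z; apply/functional_extensionality_dep=> i; exact: addrA. Qed.
Let addC : commutative add.
Proof. by move=> x y; apply/functional_extensionality_dep=> i; exact: addrC. Qed.
Let add0 : left_id zero add.
Proof. by move=> x; apply/functional_extensionality_dep=> i; exact: add0r. Qed.
Let addN : left_inverse zero opp add.
Proof. by move=> x; apply/functional_extensionality_dep=> i; exact: addNr. Qed.

HB.instance Definition _ := GRing.isZmodule.Build dirsum addA addC add0 addN.

Let scaleA a b x : scale a (scale b x) = scale (a * b) x.
Proof. by apply/functional_extensionality_dep=> i; exact: scalerA. Qed.
Let scale1 : left_id 1 scale.
Proof. by move=> x; apply/functional_extensionality_dep=> i; exact: scale1r. Qed.
Let scaleDr : right_distributive scale +%R.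
Proof. by move=> a x y; apply/functional_extensionality_dep=> i; exact: scalerDr. Qed.
Let scaleDl x : {morph scale^~ x : a b / a + b}.
Proof. by move=> a b; apply/functional_extensionality_dep=> i; exact: scalerDl. Qed.

HB.instance Definition _ :=
  GRing.Zmodule_isLmodule.Build R dirsum scaleA scale1 scaleDr scaleDl.

End FiniteDirectSum.

(* rmodType A is too large a type for the library's set and porderType, whose
   carriers lie in the same universe as the carriers of modules; subcategories
   and their order are therefore plain predicates and relations. *)

Section Subcategories.
Variable A : pzRingType.

(* A full subcategory is given by its class of objects. *)
Definition modclass : Type := rmodType A -> Prop.

Implicit Types (S T : modclass) (M N : rmodType A).

Definition subclass S T : Prop := forall M, S M -> T M.
Definition interclass S T : modclass := fun M => S M /\ T M.
Definition unionclass S T : modclass := fun M => S M \/ T M.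

Definition finitely_generated M : Prop :=
  exists (n : nat) (g : 'I_n -> M), forall m : M,
    exists a : 'I_n -> A^c, m = \sum_(i < n) a i *: g i.

Definition isomorphic M N : Prop := exists f : {linear M -> N}, bijective f.

Definition quotient_of M N : Prop := exists f : {linear M -> N}, surjective f.

(* A full subcategory of mod A, closed under isomorphisms. *)
Definition is_subcategory T : Prop :=
  subclass T finitely_generated /\
  (forall M N, T M -> isomorphic M N -> T N).

Definition contains_zero T : Prop := forall M, (forall m : M, m = 0) -> T M.

Definition quotient_closed T : Prop :=
  forall M N, T M -> quotient_of M N -> T N.

Definition dirsum_closed T : Prop :=
  forall (n : nat) (M : 'I_n -> rmodType A),
    (forall i, T (M i)) -> T (dirsum M : rmodType A).

Definition is_pretorsion_class T : Prop :=
  [/\ is_subcategory T, contains_zero T, quotient_closed T & dirsum_closed T].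

Definition Gen S : modclass := fun N =>
  exists (n : nat) (M : 'I_n -> rmodType A),
    (forall i, S (M i)) /\ quotient_of (dirsum M : rmodType A) N.

Record pretorsionClass : Type := PretorsionClass {
  objects : modclass;
  pretorsionP : is_pretorsion_class objects }.

Definition le_pretorsion (T1 T2 : pretorsionClass) : Prop :=
  subclass (objects T1) (objects T2).

End Subcategories.

Section Posets.
Variables (L : Type) (le : L -> L -> Prop).

Definition partial_order : Prop :=
  [/\ forall x, le x x,
      forall x y z, le x y -> le y z -> le x z &
      forall x y, le x y -> le y x -> x = y].

Definition is_inf (S : L -> Prop) (m : L) : Prop :=
  (forall x, S x -> le m x) /\ (forall y, (forall x, S x -> le y x) -> le y m).

Definition is_sup (S : L -> Prop) (m : L) : Prop :=
  (forall x, S x -> le x m) /\ (forall y, (forall x, S x -> le x y) -> le m y).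

Definition is_meet (x y m : L) : Prop := is_inf (fun z => z = x \/ z = y) m.
Definition is_join (x y m : L) : Prop := is_sup (fun z => z = x \/ z = y) m.

Definition complete_lattice : Prop :=
  partial_order /\
  forall S : L -> Prop, (exists m, is_inf S m) /\ (exists m, is_sup S m).

End Posets.

(* Main.v *)
(** Finitely generated modules are exactly the quotients of finite direct sums
of copies of the regular module, so they form [Gen] of one object; the same
closure properties of [Gen] then show both that [Gen S] is a pretorsion class
and that it stays inside mod A as soon as S does.  Infima are intersections
(taken inside mod A, for the empty family) and suprema are [Gen] of unions. *)
Require Import Defs.
From HB Require Import structures.
From mathcomp Require Import all_boot all_order all_algebra.
From mathcomp Require Import boolp.

Set Implicit Arguments.
Unset Strict Implicit.
Unset Printing Implicit Defensive.

Import GRing.Theory.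
Local Open Scope ring_scope.

(** Lets surjections be given as bare functions, with linearity proved separately. *)
Lemma linear_map (R : pzRingType) (U V : lmodType R) (f : U -> V) :
  linear f -> exists g : {linear U -> V}, g =1 f.
Proof.
move=> f_lin.
pose m := GRing.isLinear.Build R U V _ f f_lin.
pose g : {linear U -> V} := HB.pack f m.
by exists g.
Qed.

Lemma dependent_choice (I : Type) (T : I -> Type) (P : forall i, T i -> Prop) :
  (forall i, exists x, P i x) -> exists f, forall i, P i (f i).
Proof. by move=> h; exists (fun i => sval (cid (h i))) => i; exact: svalP. Qed.

(** * Surjections between direct sums *)

Section Quotients.
Variable A : pzRingType.
Implicit Types M N : rmodType A.

Lemma quotient_of_linear M N (f : M -> N) :
  linear f -> surjective f -> quotient_of M N.
Proof.
move=> /linear_map[g gE] f_surj; exists g => v.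
by have [u <-] := f_surj v; exists u.
Qed.

Lemma isomorphic_quotient M N : isomorphic M N -> quotient_of M N.
Proof. by move=> [f [g _ gK]]; exists f => v; exists (g v). Qed.

Lemma quotient_of_trans M N (P : rmodType A) :
  quotient_of M N -> quotient_of N P -> quotient_of M P.
Proof.
move=> [f f_surj] [g g_surj]; apply: (@quotient_of_linear _ _ (g \o f)).
  by move=> a x y /=; rewrite !linearP.
move=> w; have [v <-] := g_surj w; have [u <-] := f_surj v.
by exists u.
Qed.

Lemma dirsum_quotient (I : finType) (M N : I -> rmodType A) :
  (forall i, quotient_of (M i) (N i)) ->
  quotient_of (dirsum M : rmodType A) (dirsum N : rmodType A).
Proof.
move=> /dependent_choice[f f_surj].
apply: (@quotient_of_linear _ _ (fun x : dirsum M => (fun i => f i (x i)) : dirsum N)).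
  by move=> a x y; apply/functional_extensionality_dep => i; exact: linearP.
move=> v; have [u fu] := dependent_choice (fun i => f_surj i (v i)).
by exists u; apply/functional_extensionality_dep.
Qed.

(** Coordinate [i] of the image is read off at [h' i], so [z] has the preimage [z \o h]. *)
Lemma dirsum_reindex (I J : finType) (h : J -> I) (h' : I -> J)
    (M : I -> rmodType A) : cancel h' h ->
  quotient_of (dirsum (fun j => M (h j)) : rmodType A) (dirsum M : rmodType A).
Proof.
move=> h'K.
(* [x (h' i)] lives in [M (h (h' i))]; it is transported to [M i] along [h'K i]. *)
pose f (x : dirsum (fun j => M (h j))) : dirsum M :=
  fun i => ecast i' (M i') (h'K i) (x (h' i)).
apply: (@quotient_of_linear _ _ f).
  move=> a x y; apply/functional_extensionality_dep => i.
  (* Both ends of the equality are made variables, so that it can be eliminated. *)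
  have castP i1 i2 (e : i1 = i2) (u v : M i1) :
    ecast i' (M i') e (a *: u + v) = a *: ecast i' (M i') e u + ecast i' (M i') e v.
    by case: _ / e.
  exact: castP.
move=> z; exists (fun j => z (h j)).
apply/functional_extensionality_dep => i.
have castE i1 i2 (e : i1 = i2) : ecast i' (M i') e (z i1) = z i2 by case: _ / e.
exact: castE.
Qed.

(** Currying: a family indexed by pairs is a family of families. Operations are pointwise, so
    linearity holds by computation. *)
Lemma dirsum_tagged (I : finType) (J : I -> finType)
    (M : forall i, J i -> rmodType A) :
  quotient_of (dirsum (fun k : {i : I & J i} => M (tag k) (tagged k)) : rmodType A)
              (dirsum (fun i => dirsum (@M i) : rmodType A) : rmodType A).
Proof.
apply: (@quotient_of_linear _ _
  (fun x : dirsum (fun k : {i : I & J i} => M (tag k) (tagged k)) =>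
    (fun i => (fun j => x (Tagged J j)) : dirsum (@M i))
      : dirsum (fun i => dirsum (@M i) : rmodType A))).
  by [].
by move=> z; exists (fun k => z (tag k) (tagged k)).
Qed.

End Quotients.

(** * Quotients of finite direct sums, and finite generation *)

Section Gen.
Variable A : pzRingType.
Implicit Types (S T : modclass A) (M N : rmodType A).

(** Frees [Gen] from ordinal indices; a sum of sums is naturally indexed by a sigma type. *)
Lemma Gen_dirsum (I : finType) S (M : I -> rmodType A) N :
    (forall i, S (M i)) -> quotient_of (dirsum M : rmodType A) N -> Gen S N.
Proof.
move=> SM quot; exists #|I|, (fun j => M (enum_val j)); split=> //.
exact: quotient_of_trans (dirsum_reindex M enum_rankK) quot.
Qed.

Lemma Gen_contains_zero S : contains_zero (Gen S).
Proof.
(* The empty sum maps onto [N]; the constant family [N] over ['I_0] is only a filler. *)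
move=> N N0; exists 0%N, (fun=> N); split; first by case.
apply: (@quotient_of_linear _ _ _ (fun=> 0)).
  by move=> a x y; rewrite scaler0 addr0.
by move=> v; exists 0; rewrite (N0 v).
Qed.

Lemma Gen_quotient_closed S : quotient_closed (Gen S).
Proof.
move=> M N [n [X [SX quotM]]] quotN; exists n, X; split=> //.
exact: quotient_of_trans quotM quotN.
Qed.

Lemma Gen_dirsum_closed S : dirsum_closed (Gen S).
Proof.
move=> n N GN.
(* [N i] is a quotient of the sum of the [p i] modules [X i j]; all these summands together, indexed
   by pairs, cover the sum of the [N i]. *)
have [p pP] := dependent_choice GN; have [X XP] := dependent_choice pP.
have SX i : forall j, S (X i j) by have [] := XP i.
have quotX i : quotient_of (dirsum (X i) : rmodType A) (N i) by have [] := XP i.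
apply: (@Gen_dirsum {i : 'I_n & 'I_(p i)} S (fun k => X (tag k) (tagged k))).
  by move=> k; exact: SX.
exact: quotient_of_trans (dirsum_tagged X) (dirsum_quotient quotX).
Qed.

Lemma sub_Gen S : subclass S (Gen S).
Proof.
move=> M SM; exists 1%N, (fun=> M); split=> //.
apply: (@quotient_of_linear _ _ _ (fun x : dirsum (fun _ : 'I_1 => M) => x ord0)).
  by [].
by move=> m; exists (fun=> m).
Qed.

(** Serves twice: with [T] the finitely generated modules it keeps [Gen S] inside mod A, and with
    [T] an upper bound it gives the least property of suprema. *)
Lemma Gen_min S T : quotient_closed T -> dirsum_closed T ->
  subclass S T -> subclass (Gen S) T.
Proof.
move=> Tquot Tsum ST N [n [X [SX quotN]]].
by apply: Tquot quotN; apply: Tsum => i; exact: ST.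
Qed.

(** Generators [g] give the surjection from [F n] sending coefficients to their combination;
    conversely, a surjection sends the standard basis to generators. *)
Lemma finitely_generatedE M :
  finitely_generated M <-> Gen (fun N => N = A^c^o :> rmodType A) M.
Proof.
pose F n : rmodType A := dirsum (fun _ : 'I_n => A^c^o : rmodType A).
split=> [[n [g gP]]|[n [X [XE]]]].
  exists n, (fun=> A^c^o : rmodType A); split=> //.
  apply: (@quotient_of_linear _ (F n) M (fun c => \sum_(i < n) (c i : A^c) *: g i)).
    move=> a x y; rewrite scaler_sumr -big_split /=; apply: eq_bigr => i _.
    by rewrite scalerDl scalerA.
  by move=> m; have [a ->] := gP m; exists a.
have -> : X = (fun=> A^c^o : rmodType A) by apply/functional_extensionality_dep.
move=> [f f_surj].
(* The standard basis of the free module [F n]. *)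
pose e (i : 'I_n) : F n := fun j => (i == j)%:R.
exists n, (fun i => f (e i)) => m; have [c <-] := f_surj m.
exists c; under eq_bigr do rewrite -linearZ; rewrite -linear_sum /=; congr (f _).
apply/functional_extensionality_dep => j.
have sumE (r : seq 'I_n) (x : 'I_n -> F n) :
    (\sum_(i <- r) x i) j = \sum_(i <- r) x i j :> A^c^o.
  by elim: r => [|i r IHr]; rewrite ?big_nil // !big_cons -IHr.
rewrite sumE (bigD1 j) //= big1 => [|i /negPf ij]; last first.
  (* Scaling in [F n] is coordinatewise multiplication in [A^c], which [change] exposes. *)
  by change ((c i : A^c) * (i == j)%:R = 0); rewrite ij mulr0.
by change (c j = (c j : A^c) * (j == j)%:R + 0); rewrite eqxx mulr1 addr0.
Qed.

Lemma finitely_generated_quotient_closed :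
  quotient_closed (@finitely_generated A).
Proof.
move=> M N /finitely_generatedE GM quot; apply/finitely_generatedE.
exact: Gen_quotient_closed GM quot.
Qed.

Lemma finitely_generated_dirsum_closed :
  dirsum_closed (@finitely_generated A).
Proof.
move=> n M fgM; apply/finitely_generatedE/Gen_dirsum_closed => i.
exact/finitely_generatedE.
Qed.

Lemma Gen_pretorsion S :
  subclass S (@finitely_generated A) -> is_pretorsion_class (Gen S).
Proof.
move=> Sfg; split; [split | exact: Gen_contains_zero
  | exact: Gen_quotient_closed | exact: Gen_dirsum_closed].
  apply: Gen_min => //; first exact: finitely_generated_quotient_closed.
  exact: finitely_generated_dirsum_closed.
by move=> M N GM /isomorphic_quotient; exact: Gen_quotient_closed.
Qed.

End Gen.

(** * The order on pretorsion classes, infima and suprema *)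

Section Lattice.
Variable A : pzRingType.
Implicit Types (T : pretorsionClass A) (S : pretorsionClass A -> Prop).

Lemma pretorsion_fg T : subclass (objects T) (@finitely_generated A).
Proof. by have [[]] := pretorsionP T. Qed.

Lemma pretorsion_zero T : contains_zero (objects T).
Proof. by have [] := pretorsionP T. Qed.

Lemma pretorsion_quotient T : quotient_closed (objects T).
Proof. by have [] := pretorsionP T. Qed.

Lemma pretorsion_dirsum T : dirsum_closed (objects T).
Proof. by have [] := pretorsionP T. Qed.

Lemma modclass_ext (C D : modclass A) :
  subclass C D -> subclass D C -> C = D.
Proof.
move=> CD DC; apply/functional_extensionality_dep => M.
by apply/propext; split=> [/CD|/DC].
Qed.

Lemma le_pretorsion_partial_order : partial_order (@le_pretorsion A).
Proof.
split=> [T M //|T1 T2 T3 le12 le23 M /le12/le23 //|].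
move=> [C C_pt] [D D_pt] le12 le21.
have eqCD : C = D by exact: modclass_ext.
(* Once the classes agree, the records differ only in their proofs, which are equal by proof
   irrelevance. *)
by move: D_pt {le12 le21}; rewrite -eqCD => D_pt; congr PretorsionClass.
Qed.

Lemma inter_pretorsion S : is_pretorsion_class
  (fun M => finitely_generated M /\ forall T, S T -> objects T M).
Proof.
have quot : quotient_closed
    (fun M => finitely_generated M /\ forall T, S T -> objects T M).
  move=> M N [fgM SM] MN; split.
    exact: finitely_generated_quotient_closed MN.
  by move=> T /SM TM; exact: pretorsion_quotient MN.
split=> //; first split.
- by move=> M [].
- by move=> M N SM /isomorphic_quotient; exact: quot.
- move=> M M0; split; last by move=> T _; exact: pretorsion_zero.
  exact/finitely_generatedE/Gen_contains_zero.
- move=> n M SM; split.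
    by apply: finitely_generated_dirsum_closed => i; have [] := SM i.
  by move=> T ST; apply: pretorsion_dirsum => i; have [_] := SM i; apply.
Qed.

Lemma inter_is_inf S T :
  objects T = (fun M => finitely_generated M /\ forall U, S U -> objects U M) ->
  is_inf (@le_pretorsion A) S T.
Proof.
rewrite /is_inf /le_pretorsion => ->; split=> [U SU M [_]|U leU M UM]; first exact.
(* A lower bound [U] lies in mod A by itself, which settles the case of empty [S]. *)
by split=> [|V SV]; [exact: pretorsion_fg UM | exact: leU UM].
Qed.

Lemma union_fg S :
  subclass (fun M => exists2 T, S T & objects T M) (@finitely_generated A).
Proof. by move=> M [T _]; exact: pretorsion_fg. Qed.

Lemma Gen_is_sup S T :
  objects T = Gen (fun M => exists2 U, S U & objects U M) ->
  is_sup (@le_pretorsion A) S T.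
Proof.
rewrite /is_sup /le_pretorsion => ->; split=> [U SU M UM|U leU].
  by apply: sub_Gen; exists U.
apply: Gen_min; [exact: pretorsion_quotient | exact: pretorsion_dirsum |].
by move=> M [V SV]; exact: leU.
Qed.

Lemma pretorsion_complete_lattice : complete_lattice (@le_pretorsion A).
Proof.
split=> [|S]; first exact: le_pretorsion_partial_order.
split.
- by exists (PretorsionClass (inter_pretorsion S)); exact: inter_is_inf.
- by exists (PretorsionClass (Gen_pretorsion (@union_fg S))); exact: Gen_is_sup.
Qed.

End Lattice.

Theorem proposition3p4 (k : closedFieldType) (A : pzRingType)
    (iota : {rmorphism k -> A}) (hA : fin_dim_algebra iota) :
  complete_lattice (@le_pretorsion A) /\
  forall T1 T2 : pretorsionClass A,
    (exists T : pretorsionClass A,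
       objects T = interclass (objects T1) (objects T2) /\
       is_meet (@le_pretorsion A) T1 T2 T) /\
    (exists T : pretorsionClass A,
       objects T = Gen (unionclass (objects T1) (objects T2)) /\
       is_join (@le_pretorsion A) T1 T2 T).
Proof.
split=> [|T1 T2]; first exact: pretorsion_complete_lattice.
(* Meet and join are the infimum and supremum of this pair; what remains is to identify the
   underlying classes. *)
pose S T := T = T1 \/ T = T2; split.
- exists (PretorsionClass (inter_pretorsion S)); split; last exact: inter_is_inf.
  apply: modclass_ext => M.
    by case=> _ SM; split; apply: SM; [left | right].
  (* Finite generation is inherited from [T1]. *)
  case=> T1M T2M; split; first exact: pretorsion_fg T1M.
  by move=> T [] ->.
- exists (PretorsionClass (Gen_pretorsion (@union_fg _ S))).
  split; last exact: Gen_is_sup.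
  congr Gen; apply: modclass_ext => M.
    by case=> T [] ->; [left | right].
  by case=> TM; [exists T1 => //; left | exists T2 => //; right].
Qed.
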